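(* Let $d\ge 4$ be an integer. There exist a constant $c_d>0$ and an integer $n_0(d)$ such that for every $n\ge n_0(d)$: if $\mathcal{F}\subseteq\binom{[n]}{d+1}$ has VC-dimension at most $d$, then $|\mathcal{F}|\le\binom{n}{d}-c_d n^{d-4}$.
   Context: $\binom{[n]}{k}$ denotes the family of all $k$-element subsets of $[n]$. A family $\mathcal{F}$ shatters $S$ if for every $A\subseteq S$ there is $F\in\mathcal{F}$ with $F\cap S=A$; the VC-dimension of $\mathcal{F}$ is the largest size of a shattered set. *)

(* Defs.v *)
From mathcomp Require Import all_boot all_order all_algebra.
Set Implicit Arguments. Unset Strict Implicit. Unset Printing Implicit Defensive.

Definition shatters (T : finType) (F : {set {set T}}) (S : {set T}) : bool :=
  [forall A in powerset S, [exists G in F, G :&: S == A]].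

Definition VCdim_le (T : finType) (F : {set {set T}}) (d : nat) : bool :=
  [forall S : {set T}, shatters F S ==> (#|S| <= d)].

Definition uniform (T : finType) (F : {set {set T}}) (k : nat) : bool :=
  [forall G in F, #|G| == k].

(* Main.v *)
Require Import Defs.
From mathcomp Require Import all_boot all_order all_algebra.
Import Order.TTheory GRing.Theory Num.Theory.
Set Implicit Arguments. Unset Strict Implicit. Unset Printing Implicit Defensive.

(** Let [m = 'C(n, d) - #|F|].  An octahedron consists of [d] pairs of points, and its
    [2 ^ d] facets (one point from each pair) carry a signed indicator function that is
    null: its sum over the [d]-sets containing a given smaller set is 0.  Given more than
    [m] octahedra pairwise sharing at most [d - 3] points, their functions and the shadow
    vectors of the members of [F] are linearly dependent.  As in the argument of Frankl
    and Pach, the coefficient of a member [G] of [F] is read off from the sets [G :\ x]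
    with [x] outside a trace missing on [G]; it follows that one of the octahedra has a
    centre: a point [z] outside it such that [F] contains the cone with apex [z] over the
    octahedron, every [z |: T] having a missing trace inside the facet [T].  Two
    octahedra with a common facet have the same centre as soon as the centre of the first
    is not a vertex of the second.
    Take about [n ^ (d - 3)] sets of [2 d + 2] points meeting pairwise in at most [d - 4]
    points, with an octahedron in each of them.  At most [m] of these octahedra have no
    centre, so if [m] is less than a small multiple of [n ^ (d - 4)], more than [m] of
    them have the same centre [z].  Adding [z] to the corresponding sets leaves them far
    apart, which yields in one of the enlarged sets a centred octahedron having [z] as a
    vertex, and this contradicts the uniqueness of centres. *)

(** * Linear algebra *)

Lemma linear_dependence (R : fieldType) (I J : finType) (v : I -> J -> R) :
  #|J| < #|I| ->
  exists2 c : I -> R, (exists i, c i != 0%R) &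
    forall j, (\sum_i c i * v i j = 0)%R.
Proof.
move=> ltJI; pose M := (\matrix_(i < #|I|, j < #|J|) v (enum_val i) (enum_val j))%R.
have : kermx M != 0%R.
  rewrite -mxrank_eq0 mxrank_ker -lt0n subn_gt0.
  exact: leq_ltn_trans (rank_leq_col _) ltJI.
case/rowV0Pn => a /sub_kermxP aM0 a_n0.
exists (fun i => a ord0 (enum_rank i)).
  case/rV0Pn: a_n0 => k ak; exists (enum_val k).
  by rewrite enum_valK.
move=> j; move/matrixP/(_ ord0 (enum_rank j)): aM0; rewrite !mxE => aM0.
rewrite -[RHS]aM0.
rewrite (reindex (@enum_val I I)) /=; last by apply: onW_bij; exact: enum_val_bij.
by apply: eq_bigr => i _; rewrite !mxE enum_valK enum_rankK.
Qed.

(** * Weights on a uniform family with prescribed shadow sums *)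

Section Weights.

Variables (V : finType) (R : comPzRingType) (d : nat).
Variables (F : {set {set V}}) (a : {set V} -> R) (u : {set V} -> R).
Hypothesis unifF : uniform F d.+1.
Hypothesis shadow_a :
  forall X : {set V}, #|X| = d -> (\sum_(G in F | X \subset G) a G = u X)%R.
Hypothesis shadow_a0 :
  forall X : {set V}, #|X| < d -> (\sum_(G in F | X \subset G) a G = 0)%R.

(** When [P] and [Q] partition a set [G], this is the total weight of the members whose trace on [G]
    is [P]; it is an empty sum if that trace is missing. *)
Let N (P Q : {set V}) := (\sum_(G in F | (P \subset G) && [disjoint Q & G]) a G)%R.

Let N0 (P : {set V}) : N P set0 = (\sum_(G in F | P \subset G) a G)%R.
Proof.
by apply: eq_bigl => G; rewrite disjoints_subset sub0set andbT.
Qed.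

Let NU (P Q : {set V}) x : x \in Q -> N P Q = (N P (Q :\ x) - N (x |: P) (Q :\ x))%R.
Proof.
move=> xQ; apply/eqP; rewrite eq_sym subr_eq addrC; apply/eqP.
rewrite /N (bigID (fun G : {set V} => x \in G)) /=.
congr (_ + _)%R; apply: eq_bigl => G.
  rewrite subUset sub1set.
  by case: (x \in G); rewrite /= ?andbT ?andbF.
rewrite -[in RHS](setD1K xQ) -!setI_eq0 setIUl setU_eq0.
have -> : ([set x] :&: G == set0) = (x \notin G).
  by rewrite setI_eq0 disjoints1.
by case: (x \in G); rewrite /= ?andbT ?andbF.
Qed.

Let moveU (P Q : {set V}) x : x \in Q -> (x |: P) :|: (Q :\ x) = P :|: Q.
Proof. by move=> xQ; rewrite setUAC setD1K // setUC. Qed.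

Let N_small (P Q : {set V}) : #|P :|: Q| < d -> N P Q = 0%R.
Proof.
have [m] := ubnP #|Q|; elim: m P Q => // m IH P Q leQ ltPQ.
have [->|[x xQ]] := set_0Vmem Q.
  rewrite N0; apply: shadow_a0.
  exact: leq_ltn_trans (subset_leq_card (subsetUl _ _)) ltPQ.
have ltQ : #|Q :\ x| < m by move: leQ; rewrite (cardsD1 x) xQ.
rewrite (NU _ xQ) !IH ?subr0 ?moveU //.
apply: leq_ltn_trans ltPQ; apply: subset_leq_card; apply: setUS.
exact: subD1set.
Qed.

Let N_mid (P Q : {set V}) : [disjoint P & Q] -> #|P :|: Q| = d ->
  N P Q = ((-1) ^+ #|Q| * u (P :|: Q))%R.
Proof.
have [m] := ubnP #|Q|; elim: m P Q => // m IH P Q leQ dPQ eqPQ.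
have [Q0|[x xQ]] := set_0Vmem Q.
  by rewrite Q0 N0 cards0 expr0 mul1r setU0 shadow_a // -eqPQ Q0 setU0.
have xP : x \notin P by apply/negP => xP; rewrite (disjointFr dPQ xP) in xQ.
have eqQ : #|Q| = #|Q :\ x|.+1 by rewrite (cardsD1 x) xQ.
rewrite (NU _ xQ) N_small; last first.
  rewrite -eqPQ; apply: proper_card; apply/properP; split.
    by apply: setUS; exact: subD1set.
  by exists x; rewrite !inE ?xQ ?orbT // eqxx (negPf xP).
rewrite IH ?moveU //.
- by rewrite eqQ exprS sub0r !mulNr mul1r.
- by rewrite -ltnS -eqQ.
- rewrite -setI_eq0 setIUl setU_eq0; apply/andP; split.
    by rewrite setI_eq0 disjoints1 !inE eqxx.
  rewrite setI_eq0; apply: disjointWr dPQ; exact: subD1set.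
Qed.

(** [NU] moves the points of [Q] into [P] one at a time. Each move leaves a term on [d] points,
    known from [N_mid]; the last term is [a (P :|: Q)], by uniformity. *)
Let N_top (P Q : {set V}) : [disjoint P & Q] -> P :|: Q \in F ->
  N P Q = ((-1) ^+ #|Q| * (a (P :|: Q) - \sum_(x in Q) u ((P :|: Q) :\ x)))%R.
Proof.
have cF G : G \in F -> #|G| = d.+1 by move/forall_inP: unifF => h /h /eqP.
have [m] := ubnP #|Q|; elim: m P Q => // m IH P Q leQ dPQ PQF.
have [Q0|[x xQ]] := set_0Vmem Q.
  rewrite Q0 in PQF *; rewrite setU0 in PQF *.
  rewrite N0 cards0 expr0 mul1r big_set0 subr0.
  rewrite (bigD1 P) /= ?PQF ?subxx // big1 ?addr0 // => G /andP[/andP[GF PG] neG].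
  by rewrite eq_sym eqEcard PG (cF _ GF) (cF _ PQF) leqnn in neG.
have xP : x \notin P by apply/negP => xP; rewrite (disjointFr dPQ xP) in xQ.
have eqQ : #|Q| = #|Q :\ x|.+1 by rewrite (cardsD1 x) xQ.
have eqU : P :|: Q :\ x = (P :|: Q) :\ x.
  apply/setP => y; rewrite !inE; case: eqP => [->|] //=.
  by rewrite (negPf xP).
have dPQ' : [disjoint P & Q :\ x] by apply: disjointWr dPQ; exact: subD1set.
rewrite (NU _ xQ) N_mid ?eqU //; last first.
  by apply/succn_inj; rewrite -(cF _ PQF) [RHS](cardsD1 x) !inE xQ orbT.
rewrite IH ?moveU //.
- rewrite (big_setD1 x xQ) /= eqQ exprS -mulrBr mulN1r mulNr -mulrN.
  by rewrite !opprB addrA.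
- by rewrite -ltnS -eqQ.
- rewrite -setI_eq0 setIUl setU_eq0; apply/andP; split.
    by rewrite setI_eq0 disjoints1 !inE eqxx.
  by rewrite setI_eq0.
Qed.

(** The sum [N B (G :\: B)] is empty, so [N_top] determines [a G]. *)
Lemma weight_missing_trace (G B : {set V}) : G \in F -> B \subset G ->
  (forall H, H \in F -> H :&: G != B) ->
  (a G = \sum_(x in G :\: B) u (G :\ x))%R.
Proof.
move=> GF BG miss.
have dB : [disjoint B & G :\: B].
  by rewrite -setI_eq0 setIDA setDIl setDv set0I.
have eqG : B :|: G :\: B = G 
  by apply/setP => y; rewrite !inE; case: (boolP (y \in B)) => //= /(subsetP BG).
have := N_top dB; rewrite eqG => /(_ GF).
rewrite {1}/N big_pred0 => [/esym/eqP|H].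
  move/eqP/(congr1 (fun y => (-1) ^+ #|G :\: B| * y)%R).
  by rewrite signrMK mulr0 => /subr0_eq.
apply/negP => /and3P[HF BH dH]; case/negP: (miss H HF); apply/eqP/setP => y.
rewrite !inE; have [yB|yB] := boolP (y \in B).
  by rewrite (subsetP BH) // (subsetP BG).
apply/negP => /andP[yH yG].
by have := disjointFl dH yH; rewrite !inE yB yG.
Qed.

End Weights.

Lemma missing_trace (V : finType) (d : nat) (F : {set {set V}}) (G : {set V}) :
  uniform F d.+1 -> VCdim_le F d -> G \in F ->
  exists2 B : {set V}, B \subset G & forall H, H \in F -> H :&: G != B.
Proof.
move=> /forall_inP unifF /forallP/(_ G) vcF GF.
have : ~~ shatters F G.
  by apply: contraL vcF => shG; rewrite shG (eqP (unifF G GF)) ltnn.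
rewrite negb_forall_in => /exists_inP[B]; rewrite powersetE => BG.
by rewrite negb_exists_in => /forall_inP miss; exists B.
Qed.

Lemma sum_supersets1 (V : finType) (R : nmodType) (d : nat) (F : {set {set V}})
    (a : {set V} -> R) (X : {set V}) :
  uniform F d.+1 -> (forall G, G \notin F -> a G = 0%R) -> #|X| = d ->
  (\sum_(G in F | X \subset G) a G = \sum_(w | w \notin X) a (w |: X))%R.
Proof.
move=> /forall_inP unifF a0 cX.
rewrite [RHS](bigID (fun w => w |: X \in F)) /= [X in (_ + X)%R]big1; last first.
  by move=> w /andP[_]; exact: a0.
rewrite addr0.
pose A := [set w | (w \notin X) && (w |: X \in F)].
have injA : {in A &, injective (fun w => w |: X)}.
  move=> w w'; rewrite !inE => /andP[wX _] _ /setP/(_ w).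
  by rewrite !inE eqxx (negPf wX) !orbF => /esym/eqP.
rewrite (eq_bigl (mem A)) => [|w]; last by rewrite !inE.
rewrite -(big_imset _ injA); apply: eq_bigl => G.
apply/andP/imsetP => [[GF XG]|[w]]; last first.
  by rewrite inE => /andP[_ wF] ->; rewrite wF subsetUr.
have /cards1P[w Ew] : #|G :\: X| == 1.
  by rewrite cardsD (setIidPr XG) cX (eqP (unifF G GF)) subSnn.
have EG : w |: X = G by rewrite -Ew setUC -{2}(setID G X) (setIidPr XG).
exists w => //; rewrite inE EG GF andbT.
by have := set11 w; rewrite -Ew inE => /andP[].
Qed.

(** Double counting: a member containing [B] has [d.+1 - #|B|] subsets of size [d] containing [B].
    In characteristic 0, null sums on [d]-sets thus pass to smaller sets. *)
Lemma sum_shadow (V : finType) (R : pzRingType) (d : nat) (F : {set {set V}})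
    (a : {set V} -> R) (B : {set V}) :
  uniform F d.+1 -> #|B| <= d ->
  (\sum_(X : {set V} | (#|X| == d) && (B \subset X))
      \sum_(G in F | X \subset G) a G =
   (\sum_(G in F | B \subset G) a G) *+ (d.+1 - #|B|))%R.
Proof.
move=> /forall_inP unifF leBd.
rewrite (exchange_big_dep (fun G => (G \in F) && (B \subset G))) /=; last first.
  move=> X G /andP[_ BX] /andP[-> XG] /=; exact: subset_trans XG.
rewrite -sumrMnl; apply: eq_bigr => G /andP[GF BG].
rewrite sumr_const; congr (_ *+ _)%R.
have cG := eqP (unifF G GF).
have -> : d.+1 - #|B| = #|G :\: B| by rewrite cardsD (setIidPr BG) cG.
have injG : {in G :\: B &, injective (fun x => G :\ x)}.
  move=> x y; rewrite inE => /andP[_ xG] _ /setP/(_ x).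
  by rewrite !inE eqxx xG /= andbT => /esym/negbFE/eqP.
rewrite -(card_in_imset injG); apply: eq_card => X.
rewrite [LHS]unfold_in /= GF /=; apply/idP/imsetP => [|[x]].
  case/andP=> /andP[/eqP cX BX] XG.
  have /cards1P[x Ex] : #|G :\: X| == 1.
    by rewrite cardsD (setIidPr XG) cX cG subSnn.
  have : x \in G :\: X by rewrite Ex set11.
  rewrite inE => /andP[xX xG]; exists x.
    by rewrite inE xG andbT; apply: contra xX; exact: (subsetP BX).
  by rewrite -Ex setDDr setDv set0U (setIidPr XG).
rewrite inE => /andP[xB xG] ->; rewrite subD1set subsetD1 BG xB !andbT.
by have := cardsD1 x G; rewrite xG cG add1n => -[<-].
Qed.

(** * Octahedra and their signed indicator functions *)

Section Octahedra.

Variables (V : finType) (d : nat).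
Implicit Types (o : 'I_d * bool -> V) (s : {ffun 'I_d -> bool}).

Definition facet o s : {set V} := [set o (i, s i) | i : 'I_d].

Definition vertices o : {set V} := [set o p | p : 'I_d * bool].

Definition flip (i : 'I_d) s : {ffun 'I_d -> bool} :=
  [ffun j => if j == i then ~~ s j else s j].

Definition parity s : rat := (\prod_i (-1) ^+ s i)%R.

Definition octahedron o (X : {set V}) : rat :=
  (\sum_s parity s * (X == facet o s)%:R)%R.

Lemma flipK i : involutive (flip i).
Proof. by move=> s; apply/ffunP => j; rewrite !ffunE; case: eqP => //; rewrite negbK. Qed.

Lemma parity_flip i s : parity (flip i s) = (- parity s)%R.
Proof.
rewrite /parity (bigD1 i) //= [in RHS](bigD1 i) //= ffunE eqxx -mulNr.
congr (_ * _)%R; first by case: (s i); rewrite ?expr0 ?expr1 ?opprK.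
by apply: eq_bigr => j /negPf ji; rewrite ffunE ji.
Qed.

Lemma parity_sq s : (parity s * parity s = 1)%R.
Proof. by rewrite /parity -big_split /= big1 // => i _; rewrite -expr2 sqrr_sign. Qed.

(** Reindexing by [flip i] reverses every sign, so the sum is its own opposite. *)
Lemma sum_flip0 i (f : {ffun 'I_d -> bool} -> rat) :
  (forall s, f (flip i s) = f s) -> (\sum_s parity s * f s = 0)%R.
Proof.
move=> f_flip; set S := (\sum_s _)%R.
have SN : S = (- S)%R.
  rewrite {1}/S (reindex_inj (inv_inj (flipK i))) -sumrN.
  by apply: eq_bigr => s _; rewrite parity_flip f_flip mulNr.
by apply/eqP; rewrite -[_ == _](mulrn_eq0 S 2) mulr2n {1}SN addNr.
Qed.

Lemma facet_sub_vertices o s : facet o s \subset vertices o.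
Proof. by apply/subsetP => _ /imsetP[i _ ->]; apply: imset_f. Qed.

Lemma mem_facet o s i b :
  injective o -> (o (i, b) \in facet o s) = (s i == b).
Proof.
move=> inj_o; apply/imsetP/eqP => [[j _ /inj_o[-> ->]] //|<-].
by exists i.
Qed.

Lemma card_facet o s : injective o -> #|facet o s| = d.
Proof.
move=> inj_o; rewrite card_imset ?card_ord // => i j /inj_o.
by case.
Qed.

Lemma facet_inj o : injective o -> injective (facet o).
Proof.
move=> inj_o s s' eqT; apply/ffunP => i; apply/eqP.
by rewrite eq_sym -(mem_facet s' i (s i) inj_o) -eqT mem_facet.
Qed.

Lemma facet_flip o s i : injective o ->
  facet o (flip i s) = o (i, ~~ s i) |: (facet o s :\ o (i, s i)).
Proof.
move=> inj_o; apply/setP => x; rewrite !inE; apply/imsetP/idP => [[j _ ->]|].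
  rewrite ffunE; have [->|ji] := eqVneq j i; first by rewrite eqxx.
  by rewrite mem_facet // eqxx !(inj_eq inj_o) !xpair_eqE (negPf ji).
case/orP=> [/eqP->|/andP[xi /imsetP[j _ xE]]].
  by exists i => //; rewrite ffunE eqxx.
exists j => //; rewrite ffunE xE; have [ji|//] := eqVneq j i.
by rewrite xE ji eqxx in xi.
Qed.

Lemma octahedron_facet o s :
  injective o -> octahedron o (facet o s) = parity s.
Proof.
move=> inj_o; rewrite /octahedron (bigD1 s) //= eqxx mulr1 big1 ?addr0 // => s' ne.
by rewrite (inj_eq (facet_inj inj_o)) eq_sym (negPf ne) mulr0.
Qed.

Lemma octahedron_neq0 o X :
  octahedron o X != 0%R -> exists s, X = facet o s.
Proof.
move=> nz; have [/existsP[s /eqP ->]|] := boolP [exists s, X == facet o s].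
  by exists s.
rewrite negb_exists => /forallP no; case/eqP: nz; apply: big1 => s _.
by rewrite (negPf (no s)) mulr0.
Qed.

(* A set missing some antipodal pair entirely lies in a facet [T] exactly when
   it lies in the facet obtained from [T] by a switch at this pair. *)
Lemma octahedron_null o (B : {set V}) : injective o -> #|B| < d ->
  (\sum_(X : {set V} | (#|X| == d) && (B \subset X)) octahedron o X = 0)%R.
Proof.
move=> inj_o ltBd; rewrite exchange_big /=.
have [i iB] : exists i, forall b, o (i, b) \notin B.
  have [/existsP[i /andP[Bt Bf]]|] :=
    boolP [exists i, (o (i, true) \notin B) && (o (i, false) \notin B)].
    by exists i; case.
  rewrite negb_exists => /forallP hit.
  (* If [B] meets every pair, [f i] is a point of [B] in the [i]-th pair, and [B] has at least [d]
     points. *)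
  pose f i := o (i, o (i, true) \in B).
  have inj_f : injective f by move=> i j /inj_o[].
  have : [set f i | i : 'I_d] \subset B.
    apply/subsetP => _ /imsetP[i _ ->]; rewrite /f.
    have := hit i; rewrite negb_and !negbK.
    by case: (boolP (o (i, true) \in B)) => [->|] //=.
  by move/subset_leq_card; rewrite card_imset // card_ord leqNgt ltBd.
rewrite (eq_bigr (fun s => parity s * (B \subset facet o s)%:R)%R).
  apply: (sum_flip0 (i := i)) => s; congr (_ %:R)%R; congr (nat_of_bool _).
  have sub r : (B \subset facet o r) -> B \subset facet o (flip i r).
    move=> BT; rewrite facet_flip //; apply: subset_trans (subsetUr _ _).
    by rewrite subsetD1 BT iB.
  by apply/idP/idP => [/sub|/sub //]; rewrite flipK.
move=> s _; rewrite -mulr_sumr; congr (_ * _)%R.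
have [BT|BT] := boolP (B \subset facet o s).
  rewrite (bigD1 (facet o s)) /= ?card_facet ?eqxx // big1 ?addr0 //.
  by move=> X /andP[_ /negPf->].
apply: big1 => X /andP[_ BX]; case: eqP => // XE; by rewrite -XE BX in BT.
Qed.

Definition centred_at (F : {set {set V}}) o (z : V) : bool :=
  (z \notin vertices o) &&
  [forall s, (z |: facet o s \in F) &&
    [exists B : {set V}, (B \subset facet o s) &&
       [forall G in F, G :&: (z |: facet o s) != B]]].

End Octahedra.

(** * From linear dependence to a centre *)

Section Centre.

Variables (V : finType) (d : nat) (F : {set {set V}}).
Variables (a u : {set V} -> rat) (o : 'I_d * bool -> V) (g : rat).
Hypothesis unifF : uniform F d.+1.
Hypothesis vcF : VCdim_le F d.
Hypothesis inj_o : injective o.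
Hypothesis g_neq0 : g != 0%R.
Hypothesis a_out : forall G, G \notin F -> a G = 0%R.
Hypothesis shadow_a :
  forall X : {set V}, #|X| = d -> (\sum_(G in F | X \subset G) a G = u X)%R.
Hypothesis shadow_a0 :
  forall X : {set V}, #|X| < d -> (\sum_(G in F | X \subset G) a G = 0)%R.
(** The other octahedra are too far away to contribute here. The slack 2 allows for a set with
    [d - 1] points in a facet, from which one more point is removed. *)
Hypothesis u_near : forall (X : {set V}) s, #|X| = d ->
  d <= #|X :&: facet o s| + 2 -> (u X = g * octahedron o X)%R.

Let T := facet o.

Let cT s : #|T s| = d. Proof. exact: card_facet. Qed.

(* Summing [parity s] times the identity for [T s] over all [s], the terms
   [a (w |: T s)] with [w] a vertex cancel in pairs, since [w |: T s] is unchanged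
   when the pair of [w] is switched. *)
Let outer_weight : exists s z, z \notin vertices o /\ a (z |: T s) != 0%R.
Proof.
have [/existsP[s /existsP[z /andP[zo az]]]|none] :=
  boolP [exists s, exists z, (z \notin vertices o) && (a (z |: T s) != 0%R)].
  by exists s, z.
have a0 s z : z \notin vertices o -> a (z |: T s) = 0%R.
  move=> zo; apply/eqP; apply: contraR none => az.
  by apply/existsP; exists s; apply/existsP; exists z; rewrite zo.
have uT s : u (T s) = (\sum_i a (o (i, ~~ s i) |: T s))%R.
  rewrite -shadow_a // (sum_supersets1 unifF a_out (cT s)).
  rewrite (bigID (mem (vertices o))) /= [X in (_ + X)%R]big1 ?addr0; last first.
    by move=> z /andP[_]; exact: a0.
  have inj_f : {in predT &, injective (fun i : 'I_d => o (i, ~~ s i))}.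
    by move=> i j _ _ /inj_o[].
  rewrite [RHS](eq_bigl (mem predT)) // -(big_imset (fun z => a (z |: T s)) inj_f) /=.
  apply: eq_bigl => z.
  apply/andP/imsetP => [[zT /imsetP[[i b] _ zE]]|[i _ ->]].
    exists i => //; rewrite zE mem_facet // in zT *.
    by case: (s i) b zT {zE} => [] [].
  by rewrite mem_facet //; split; [case: (s i)|apply: imset_f].
have : (\sum_s parity s * u (T s) = 0)%R.
  rewrite (eq_bigr (fun s => \sum_i parity s * a (o (i, ~~ s i) |: T s)))%R.
    rewrite exchange_big big1 // => i _.
    apply: (sum_flip0 (i := i)) => s; congr a.
    rewrite /T facet_flip // ffunE eqxx negbK setUCA setD1K //.
    by rewrite mem_facet.
  by move=> s _; rewrite uT mulr_sumr.
(* By [u_near] each term is also equal to [g], so the sum is [g] times the number of sign choices,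
   which is not 0. *)
rewrite (eq_bigr (fun=> g)) => [/eqP|s _].
  rewrite sumr_const mulrn_eq0 (negPf g_neq0) orbF -leqn0 leqNgt.
  by case/negP; apply/card_gt0P; exists [ffun=> false].
rewrite (u_near (s := s)) ?setIid ?cT ?leq_addr // octahedron_facet //.
by rewrite mulrCA parity_sq mulr1.
Qed.

(** The weight [a G] is a sum of values [u (G :\ y)] with [y] outside [B]. A nonzero one must come
    from a facet, since [G :\ y] is still within the range of [u_near]. *)
Let support_trace (G : {set V}) s : G \in F -> a G != 0%R ->
  d <= #|G :&: T s|.+1 -> forall B : {set V}, B \subset G ->
  (forall H, H \in F -> H :&: G != B) ->
  exists y s', [/\ y \in G, y \notin B & G :\ y = T s'].
Proof.
move=> GF aG GT B BG miss.
have aE := weight_missing_trace unifF shadow_a shadow_a0 GF BG miss.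
have [/existsP[y /andP[]]|none] := boolP [exists y, (y \in G :\: B) && (u (G :\ y) != 0%R)].
  rewrite inE => /andP[yB yG].
  have cG : #|G :\ y| = d.
    have := cardsD1 y G; rewrite yG (eqP (forall_inP unifF G GF)) add1n.
    by case=> <-.
  rewrite (u_near (s := s)) //.
    rewrite mulf_eq0 (negPf g_neq0) /= => /octahedron_neq0[s' GE].
    by exists y, s'.
  rewrite addn2; apply: leq_trans GT _; rewrite ltnS.
  rewrite (cardsD1 y (G :&: T s)) setIDAC -add1n leq_add2r.
  by case: (y \in _).
case/eqP: aG; rewrite aE big1 // => y yGB; apply/eqP.
by apply: contraR none => uy; apply/existsP; exists y; rewrite yGB.
Qed.

(** The [d]-set [X] contains [z], so it is no facet and its shadow sum is 0. Only the cones over the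
    two facets that contain [T s :\ t] contribute to this sum, so their weights are opposite. *)
Let outer_flip z s i : z \notin vertices o -> a (z |: T s) != 0%R ->
  a (z |: T (flip i s)) != 0%R.
Proof.
move=> zo az.
have zT r : z \notin T r by apply: contra zo; apply/subsetP/facet_sub_vertices.
pose t := o (i, s i); pose t' := o (i, ~~ s i).
have tT : t \in T s by rewrite mem_facet.
pose X := z |: (T s :\ t).
have zX : z \notin T s :\ t by rewrite inE negb_and zT orbT.
have cTt : #|T s :\ t|.+1 = d by rewrite -(cT s) (cardsD1 t (T s)) tT.
have cX : #|X| = d by rewrite cardsU1 zX add1n.
have XT : T s :\ t \subset X :&: T s by rewrite subsetI subsetUr subD1set.
have XTd : d <= #|X :&: T s|.+1 by rewrite -cTt ltnS subset_leq_card.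
have u0 : u X = 0%R.
  rewrite (u_near (s := s)) //; last by rewrite addn2 ltnW.
  have [|] := eqVneq (octahedron o X) 0%R; first by move->; rewrite mulr0.
  by case/octahedron_neq0 => r XE; case/negP: (zT r); rewrite /T -XE setU11.
have tX : t \notin X.
  rewrite !inE eqxx orbF; apply: contraNneq zo => <-.
  exact: imset_f.
have t'X : t' \notin X.
  apply/negP; rewrite !inE => /orP[/eqP t'z|/andP[_]].
    by rewrite -t'z imset_f in zo.
  by rewrite mem_facet //; case: (s i).
have tt' : t' != t by rewrite (inj_eq inj_o) xpair_eqE eqxx; case: (s i).
(* If this weight were nonzero, [support_trace] would give a facet after removal of a point,
   necessarily [z]. So [w] would complete [T s :\ t] to a facet, which only [t] and [t'] do. *)
have a0 w : w \notin X -> w != t -> w != t' -> a (w |: X) = 0%R.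
  move=> wX wt wt'; apply/eqP/negPn/negP => aw.
  have wF : w |: X \in F by apply: contraR aw => /a_out->.
  have [B BG miss] := missing_trace unifF vcF wF.
  have near : d <= #|(w |: X) :&: T s|.+1.
    apply: leq_trans XTd _; rewrite ltnS; apply/subset_leq_card/setSI.
    exact: subsetUr.
  have [y [r [yG _ GE]]] := support_trace wF aw near BG miss.
  have yz : y = z.
    apply/eqP; apply: contraNT (zT r) => yz.
    by rewrite -GE !inE eq_sym yz eqxx orbT.
  have zw : w != z by apply: contraNneq wX => ->; rewrite setU11.
  have : w \in T r by rewrite -GE yz !inE eqxx zw.
  case/imsetP=> j _ wE; have [ji|ji] := eqVneq j i.
    move: wt wt'; rewrite wE ji !(inj_eq inj_o) !xpair_eqE !eqxx /=.
    by case: (s i) (r i) => [] [].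
  have : o (j, s j) \in T r.
    rewrite -GE yz !inE mem_facet // eqxx !(inj_eq inj_o) !xpair_eqE (negPf ji).
    rewrite /= !orbT andbT; apply: contraNneq zo => <-; exact: imset_f.
  rewrite mem_facet // => /eqP rs; case/negP: wX.
  by rewrite wE rs !inE mem_facet // eqxx (inj_eq inj_o) xpair_eqE (negPf ji) orbT.
have := sum_supersets1 unifF a_out cX; rewrite shadow_a // u0.
rewrite (bigD1 t) //= (bigD1 t') /=; last by rewrite t'X.
rewrite big1 ?addr0 => [|w /andP[/andP[wX wt] wt']]; last exact: a0.
have -> : t |: X = z |: T s by rewrite /X setUCA setD1K.
have -> : t' |: X = z |: T (flip i s) by rewrite /X /T facet_flip // setUCA.
by move=> E; apply: contraNneq az => E'; rewrite E E' addr0.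
Qed.

Lemma centred_of_weights : exists z, centred_at F o z.
Proof.
have [s0 [z [zo az0]]] := outer_weight; exists z; rewrite /centred_at zo /=.
have az s : a (z |: T s) != 0%R.
  (* Induction on the number of pairs at which [s] and [s0] differ, one switch at a time. *)
  have [m] := ubnP #|[pred i | s i != s0 i]|; elim: m s => // m IH s lem.
  have [/eqP/pred0P eqs|] := eqVneq #|[pred i | s i != s0 i]| 0.
    suff -> : s = s0 by [].
    by apply/ffunP => i; apply/eqP; rewrite -[_ == _]negbK; have /= -> := eqs i.
  rewrite -lt0n => /card_gt0P[i]; rewrite inE => si.
  rewrite -(flipK i s); apply: outer_flip => //; apply: IH.
  rewrite -ltnS; apply: leq_trans lem; rewrite ltnS.
  apply: proper_card; apply/properP; split.
    apply/subsetP => j; rewrite !inE ffunE; have [->|//] := eqVneq j i.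
    by rewrite si.
  by exists i; rewrite !inE ?si // ffunE eqxx; case: (s i) (s0 i) si => [] [].
apply/forallP => s; have GF : z |: T s \in F.
  by apply: contraR (az s) => /a_out->.
rewrite GF /=; have [B BG miss] := missing_trace unifF vcF GF.
have zT r : z \notin T r by apply: contra zo; apply/subsetP/facet_sub_vertices.
apply/existsP; exists B; apply/andP; split; last by apply/forall_inP.
have near : d <= #|(z |: T s) :&: T s|.+1.
  by rewrite (setIidPr (subsetUr _ _)) cT.
have [y [r [yG yB GE]]] := support_trace GF (az s) near BG miss.
(* The removed point must be [z], which lies in no facet; hence the missing trace [B] avoids [z]. *)
have yz : y = z.
  apply/eqP; apply: contraNT (zT r) => yz.
  by rewrite -GE !inE eq_sym yz eqxx.
have : B \subset (z |: T s) :\ z by rewrite subsetD1 BG -yz yB.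
by rewrite setU1K.
Qed.

End Centre.

Lemma far_octahedra_centred (V J : finType) (d : nat) (F : {set {set V}})
    (K : {set J}) (o : J -> 'I_d * bool -> V) :
  uniform F d.+1 -> VCdim_le F d ->
  {in K, forall k, injective (o k)} ->
  {in K &, forall k l, k != l -> #|vertices (o k) :&: vertices (o l)| + 2 < d} ->
  'C(#|V|, d) < #|F| + #|K| ->
  exists2 k, k \in K & exists z, centred_at F (o k) z.
Proof.
move=> unifF vcF inj_o far ltFK.
pose I : finType := ({G : {set V} | G \in F} + {k : J | k \in K})%type.
pose D : finType := {X : {set V} | #|X| == d}.
pose v (i : I) (X : D) : rat :=
  match i with
  | inl G => (val X \subset val G)%:R
  (* With this sign, a dependence says that the shadow of [a] equals the combination [u] of
     octahedra. *)
  | inr k => - octahedron (o (val k)) (val X)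
  end%R.
have ltDI : #|D| < #|I|.
  by rewrite card_sum !card_sig; move: ltFK; rewrite -card_draws cardsE.
have [c [i0 ci0] cv] := linear_dependence v ltDI.
pose a (G : {set V}) : rat := oapp (fun x => c (inl x)) 0%R (insub G).
pose g (k : J) : rat := oapp (fun x => c (inr x)) 0%R (insub k).
pose u (X : {set V}) := (\sum_(k in K) g k * octahedron (o k) X)%R.
have aE x : a (val x) = c (inl x) by rewrite /a valK.
have gE x : g (val x) = c (inr x) by rewrite /g valK.
have a_out G : G \notin F -> a G = 0%R by move=> GF; rewrite /a insubF // (negPf GF).
have shadow_a (X : {set V}) : #|X| = d -> (\sum_(G in F | X \subset G) a G = u X)%R.
  move=> /eqP cX; have := cv (Sub X cX); rewrite big_sumType /= => E.
  apply/eqP; rewrite -subr_eq0 -[X in _ == X]E; apply/eqP; congr (_ + _)%R.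
    rewrite big_mkcondr big_sub; apply: eq_bigr => x _; rewrite aE /=.
    by case: (X \subset _); rewrite ?mulr1 ?mulr0.
  by rewrite /u big_sub -sumrN; apply: eq_bigr => x _; rewrite gE /= mulrN.
have shadow_a0 (X : {set V}) : #|X| < d -> (\sum_(G in F | X \subset G) a G = 0)%R.
  move=> ltX; have := sum_shadow a unifF (ltnW ltX).
  rewrite (eq_bigr u) => [|Y /andP[/eqP cY _]]; last exact: shadow_a.
  rewrite /u exchange_big big1 => [/esym/eqP|k kK].
    by rewrite mulrn_eq0 subn_eq0 leqNgt ltnS (ltnW ltX) /= => /eqP.
  by rewrite -mulr_sumr octahedron_null ?mulr0 //; exact: inj_o.
have [/existsP[k /andP[kK gk]]|none] := boolP [exists k, (k \in K) && (g k != 0%R)].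
  exists k => //.
  apply: (centred_of_weights unifF vcF (inj_o k kK) gk a_out shadow_a shadow_a0).
  move=> X s cX near; rewrite /u (bigD1 k) //= big1 ?addr0 // => l /andP[lK lk].
  have [->|/octahedron_neq0[r XE]] := eqVneq (octahedron (o l) X) 0%R.
    by rewrite mulr0.
  (* A facet of another octahedron within the range of [u_near] would give the two octahedra at
     least [d - 2] common vertices. *)
  have := far l k lK kK lk; rewrite ltnNge; case/negP.
  apply: leq_trans near _; rewrite leq_add2r; apply: subset_leq_card.
  by rewrite XE setISS // facet_sub_vertices.
(* If no octahedron has a nonzero coefficient, then [u] is 0, and missing traces make every weight
   0, so the dependence is trivial. *)
have g0 k : k \in K -> g k = 0%R.
  move=> kK; apply/eqP; apply: contraR none => gk.
  by apply/existsP; exists k; rewrite kK.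
case/eqP: ci0; case: i0 => [x|x]; last by rewrite -gE g0 // (valP x).
rewrite -aE; have [B BG miss] := missing_trace unifF vcF (valP x).
rewrite (weight_missing_trace unifF shadow_a shadow_a0 (valP x) BG miss) big1 //.
by move=> y _; rewrite /u big1 // => k kK; rewrite g0 // mul0r.
Qed.

(** * Uniqueness of centres *)

Section CommonFacet.

Variables (V : finType) (d : nat) (F : {set {set V}}).
Implicit Types (o : 'I_d * bool -> V).

Lemma centred_eq o o' z z' : injective o -> injective o' ->
  (forall i, o (i, false) = o' (i, false)) ->
  centred_at F o z -> centred_at F o' z' -> z \notin vertices o' -> z = z'.
Proof.
move=> inj_o inj_o' eq_o /andP[zo /forallP/(_ [ffun=> false])/andP[_ /existsP[B]]].
case/andP=> BT /forall_inP miss /andP[zo' /forallP ctr'] zV'.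
(* This facet of [o'] keeps the points of [B] and takes the antipodes in [o'] of the rest of the
   common facet. If [z] and [z'] differ, its cone with apex [z'] has the forbidden trace [B]. *)
pose s := [ffun i => o (i, false) \notin B].
have /andP[GF _] := ctr' s.
apply/eqP; apply: contraNT (miss _ GF) => zz'; apply/eqP/setP => x.
rewrite !inE; apply/andP/idP => [[xG /orP[/eqP xz|/imsetP[i _ xE]]]|xB].
- case/negP: zV'; apply: (subsetP (facet_sub_vertices o' s)).
  by move: xG; rewrite xz (negPf zz').
- rewrite ffunE in xE.
  case/orP: xG => [/eqP xz'|]; first by rewrite -xz' xE eq_o imset_f in zo'.
  by rewrite xE [X in X \in _]eq_o mem_facet // ffunE => /eqP/negbFE.
- have xT := subsetP BT x xB; split; last by rewrite xT orbT.
  case/imsetP: xT => i _; rewrite ffunE => xE; apply/orP; right.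
  by rewrite xE eq_o mem_facet // ffunE -xE xB.
Qed.

Definition replace_vertex o (p : 'I_d * bool) (w : V) : 'I_d * bool -> V :=
  fun q => if q == p then w else o q.

Lemma replace_vertex_inj o p w :
  injective o -> w \notin vertices o -> injective (replace_vertex o p w).
Proof.
move=> inj_o wo q r; rewrite /replace_vertex.
case: eqP => [->|_]; case: eqP => [->|_] //; last exact: inj_o.
- by move=> wE; rewrite wE imset_f in wo.
- by move=> wE; rewrite -wE imset_f in wo.
Qed.

Lemma mem_replace_vertex o p w x : injective o ->
  (x \in vertices (replace_vertex o p w)) =
  (x == w) || ((x \in vertices o) && (x != o p)).
Proof.
move=> inj_o; rewrite /replace_vertex; apply/imsetP/idP => [[q _ ->]|].
  have [_|qp] := eqVneq q p; first by rewrite eqxx.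
  by rewrite imset_f // (inj_eq inj_o) qp orbT.
case/orP=> [/eqP->|/andP[/imsetP[q _ ->] qp]]; first by exists p; rewrite ?eqxx.
by rewrite (inj_eq inj_o) in qp; exists q; rewrite // (negPf qp).
Qed.

(** The three octahedra share the facet of vertices [o (j, false)], so [z2 = z]. As [z1] differs
    from [z], it must be a vertex of [o], hence the replaced vertex [o (i, true)]; this is not in
    the third octahedron, so [z1 = z2]. *)
Lemma centre_not_vertex o i z w z1 z2 :
  injective o -> centred_at F o z -> w \notin vertices o -> w != z ->
  centred_at F (replace_vertex o (i, true) z) z1 ->
  centred_at F (replace_vertex o (i, true) w) z2 -> False.
Proof.
move=> inj_o ctr wo wz; set o1 := replace_vertex o _ z; set o2 := replace_vertex o _ w.
move=> ctr1 ctr2.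
have [[zo _] [zo1 _]] := (andP ctr, andP ctr1).
have inj1 : injective o1 by exact: replace_vertex_inj.
have inj2 : injective o2 by exact: replace_vertex_inj.
have eq1 j : o1 (j, false) = o (j, false) by rewrite /o1 /replace_vertex xpair_eqE andbF.
have eq2 j : o2 (j, false) = o (j, false) by rewrite /o2 /replace_vertex xpair_eqE andbF.
have zz2 : z = z2.
  apply: (centred_eq inj_o inj2 _ ctr ctr2) => //.
  by rewrite mem_replace_vertex // negb_or eq_sym wz (negPf zo).
move: (zo1); rewrite mem_replace_vertex // negb_or => /andP[z1z].
rewrite negb_and negbK => /orP[z1o|/eqP z1E].
  by case/eqP: z1z; apply: (centred_eq inj1 inj_o).
case/eqP: z1z; rewrite zz2; apply: (centred_eq inj1 inj2 _ ctr1 ctr2).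
  by move=> j; rewrite eq1 eq2.
rewrite mem_replace_vertex // negb_or negb_and z1E eqxx orbT andbT.
by apply: contraNneq wo => <-; exact: imset_f.
Qed.

End CommonFacet.

(** * Packings of octahedra and the final count *)

(** Each [h f] labels an octahedron by [inl] and two spare points by [inr]. The index set splits by
    the chosen centre, or its absence, into [#|V|.+1] classes of size at most [m]. *)
Lemma packing_bound (V J : finType) (d : nat) (F : {set {set V}})
    (h : J -> 'I_d * bool + bool -> V) :
  0 < d -> uniform F d.+1 -> VCdim_le F d ->
  (forall f g p q, h f p = h g q -> p = q) ->
  (forall f g, f != g -> #|[set p | h f p == h g p]| + 3 < d) ->
  #|J| <= #|V|.+1 * ('C(#|V|, d) - #|F|).
Proof.
move=> d_gt0 unifF vcF inj_h far_h.
pose i0 := Ordinal d_gt0; set m := _ - _.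
pose o f p := h f (inl p).
have inj_o f : injective (o f) by move=> p q /inj_h[].
pose M f : {set V} := [set h f p | p : 'I_d * bool + bool].
have oM f : vertices (o f) \subset M f.
  by apply/subsetP => _ /imsetP[p _ ->]; apply: imset_f.
have far_M f g z : f != g -> #|(z |: M f) :&: (z |: M g)| + 2 < d.
  move=> fg; apply: leq_ltn_trans (far_h f g fg).
  rewrite -setUIr -[3]/(1 + 2) addnA leq_add2r addnC.
  apply: leq_trans (leq_card_setU _ _) _; rewrite cards1 leq_add2l.
  have sub : M f :&: M g \subset h f @: [set p | h f p == h g p].
    apply/subsetP => x; rewrite inE => /andP[/imsetP[p _ ->] /imsetP[q _ fpgq]].
    by apply: imset_f; rewrite inE {2}(inj_h _ _ _ _ fpgq) fpgq.
  exact: leq_trans (subset_leq_card sub) (leq_imset_card _ _).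
have few (K : {set J}) (r : J -> 'I_d * bool -> V) (z : V) :
    {in K, forall f, injective (r f)} ->
    {in K, forall f, vertices (r f) \subset z |: M f} ->
    {in K, forall f, ~ exists z', centred_at F (r f) z'} -> #|K| <= m.
  move=> inj_r rM nctr; rewrite leqNgt; apply/negP => ltK.
  have [||f fK] := @far_octahedra_centred V J d F K r unifF vcF inj_r.
  - move=> f g fK gK fg; apply: leq_ltn_trans (far_M f g z fg).
    by rewrite leq_add2r; apply/subset_leq_card/setISS; apply: rM.
  - apply: (@leq_ltn_trans (#|F| + m)); first by rewrite -leq_subLR.
    by rewrite ltn_add2l.
  - exact: nctr.
pose ctr f := [pick z | centred_at F (o f) z].
have fibre x : #|[set f | ctr f == x]| <= m.
  case: x => [z|]; last first.
    have [->|[f _]] := set_0Vmem [set f | ctr f == None]; first by rewrite cards0.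
    apply: (few _ o (o f (i0, true))) => [g _|g _|g]; first exact: inj_o.
      exact: subset_trans (oM g) (subsetUr _ _).
    by rewrite inE /ctr; case: pickP => // no _ [z]; rewrite no.
  (* The spare point [w f] is chosen different from [z]. *)
  pose b f := h f (inr true) == z.
  pose w f := h f (inr (~~ b f)).
  pose o1 f := replace_vertex (o f) (i0, true) z.
  pose o2 f := replace_vertex (o f) (i0, true) (w f).
  (* By [centre_not_vertex], [o1 f] and [o2 f] are not both centred; [r f] is one without a
     centre. *)
  pose r f := if [exists z', centred_at F (o1 f) z'] then o2 f else o1 f.
  have wo f : w f \notin vertices (o f).
    by apply/negP => /imsetP[p _ /inj_h].
  have wz f : w f != z.
    rewrite /w; have [E|] := eqVneq (h f (inr true)) z; last first.
      by move=> ne; rewrite /b (negPf ne); exact: ne.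
    by rewrite /b E eqxx -E; apply/eqP => /inj_h/eqP.
  have ctrz f : f \in [set f | ctr f == Some z] -> centred_at F (o f) z.
    by rewrite inE /ctr; case: pickP => // z' cz' /eqP[<-].
  have zo f : f \in [set f | ctr f == Some z] -> z \notin vertices (o f).
    by move/ctrz/andP=> [].
  apply: (few _ r z) => f fK.
  - by rewrite /r; case: ifP => _; apply: replace_vertex_inj => //; exact: zo.
  - apply/subsetP => x; rewrite /r !inE; case: ifP => _; rewrite mem_replace_vertex //.
      case/orP=> [/eqP->|/andP[/(subsetP (oM f))-> _]]; last exact: orbT.
      by apply/orP; right; apply: imset_f.
    by case/orP=> [->//|/andP[/(subsetP (oM f))-> _]]; exact: orbT.
  - case=> z2; rewrite /r; case: ifP => [/existsP[z1 c1] c2|/negbT/negP no c].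
      exact: (centre_not_vertex (inj_o f) (ctrz f fK) (wo f) (wz f) c1 c2).
    by apply: no; apply/existsP; exists z2.
rewrite -sum1_card (partition_big ctr predT) //=.
apply: leq_trans (_ : \sum_(x : option V) m <= _); last first.
  by rewrite sum_nat_const card_option.
by apply: leq_sum => x _; rewrite sum1dep_card.
Qed.

(* The value of the polynomial with coefficients [f] at the [i]-th point is stored in
   the [i]-th block. *)
Lemma polynomial_packing (P : finType) (e : nat) :
  exists2 C, 0 < C & forall A n, 0 < A -> A * C <= n ->
  exists2 h : {ffun 'I_e -> 'I_A} -> P -> 'I_n,
    (forall f g p q, h f p = h g q -> p = q) &
    (forall f g, f != g -> #|[set p | h f p == h g p]| < e).
Proof.
(* Values are at most [A * (e * m ^ e)], so blocks of length [A * L] suffice. The successor in the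
   next line keeps the constant positive even if [P] is empty. *)
set m := #|P|; pose L := (e * m ^ e).+1.
exists (m * L).+1 => // A n A_gt0 leAn.
pose ev (f : {ffun 'I_e -> 'I_A}) (p : P) := \sum_(k < e) f k * enum_rank p ^ k.
have ltev f p : ev f p < A * L.
  have m_gt0 : 0 < m by apply/card_gt0P; exists p.
  apply: leq_ltn_trans (_ : A * (e * m ^ e) < _); last by rewrite ltn_pmul2l.
  apply: (@leq_trans (\sum_(k < e) A * m ^ e)); last by rewrite sum_nat_const card_ord mulnCA.
  apply: leq_sum => k _.
  apply: leq_mul; first exact: ltnW.
  apply: leq_trans (leq_pexp2l m_gt0 (ltnW (ltn_ord k))).
  by case: (posnP k) => [->|k_gt0]; rewrite ?expn0 // leq_exp2r // ltnW.
have ltn_h f p : enum_rank p * (A * L) + ev f p < n.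
  apply: leq_trans leAn; rewrite mulnS (mulnCA A m L); apply: ltn_addl.
  apply: leq_trans (_ : (enum_rank p).+1 * (A * L) <= _).
    by rewrite mulSn addnC ltn_add2r.
  by rewrite leq_mul2r ltn_ord orbT.
exists (fun f p => Ordinal (ltn_h f p)).
  move=> f g p q /(congr1 val)/(congr1 (fun x => x %/ (A * L))) /=.
  rewrite !divnMDl ?muln_gt0 ?A_gt0 // !divn_small // !addn0.
  by move/val_inj/enum_rank_inj.
move=> f g fg; set S := [set p | _].
pose pol (f : {ffun 'I_e -> 'I_A}) : {poly rat} :=
  (\poly_(k < e) (if insub k is Some i then (f i : nat)%:R else 0))%R.
have coef_pol f' (k : 'I_e) : ((pol f')`_k = (f' k : nat)%:R)%R.
  by rewrite coef_poly ltn_ord valK.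
have pol_ev f' p : ((pol f').[(enum_rank p)%:R] = (ev f' p)%:R)%R.
  rewrite horner_poly natr_sum; apply: eq_bigr => k _.
  by rewrite valK natrM natrX.
(* The difference has size at most [e], so fewer than [e] roots, and every agreement of [h f] and
   [h g] is a root. *)
have nz : (pol f - pol g != 0)%R.
  apply: contraNneq fg => /subr0_eq E; apply/eqP/ffunP => k; apply/val_inj/eqP.
  by rewrite /= -(eqr_nat rat) -!coef_pol E.
pose rs : seq rat := [seq (enum_rank p)%:R%R | p <- enum S].
have -> : #|S| = size rs by rewrite size_map cardE.
apply: leq_trans (max_poly_roots nz _ _) _.
- apply/allP => _ /mapP[p pS ->]; rewrite mem_enum inE in pS.
  rewrite /root hornerD hornerN !pol_ev subr_eq0 eqr_nat.
  by move/eqP/(congr1 val): pS => /= /addnI->.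
- rewrite map_inj_uniq ?enum_uniq // => p q /eqP; rewrite eqr_nat.
  by move/eqP/val_inj/enum_rank_inj.
- apply: leq_trans (size_polyD _ _) _; rewrite size_polyN geq_max.
  by rewrite !size_poly.
Qed.

Theorem theorem4p1 (d : nat) (hd : 4 <= d) :
  exists (c : rat) (n0 : nat), (0 < c)%R /\
    forall (n : nat), n0 <= n ->
    forall F : {set {set 'I_n}},
      uniform F d.+1 -> VCdim_le F d ->
      (#|F|%:R <= ('C(n, d))%:R - c * (n%:R) ^+ (d - 4) :> rat)%R.
Proof.
have [C C_gt0 pack] := polynomial_packing ('I_d * bool + bool)%type (d - 3).
set e := d - 3 in pack.
have eE : e = (d - 4).+1 by rewrite -subSn.
(* Since [A] is at least [n / (2 * C)], the bound [A ^ e <= n.+1 * m] and [n.+1 <= 2 * n] give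
   [n ^ (d - 4) <= 2 * (2 * C) ^ e * m]. *)
exists ((2 * (2 * C) ^ e)%:R^-1)%R, C; split.
  by rewrite invr_gt0 ltr0n muln_gt0 expn_gt0 muln_gt0 C_gt0.
move=> n leCn F unifF vcF; set c := (_^-1)%R.
pose A := n %/ C.
have A_gt0 : 0 < A by rewrite divn_gt0.
have leAn : A * C <= n by rewrite leq_trunc_div.
have ltnA : n <= A * (2 * C).
  rewrite mulnCA mul2n -addnn; apply: leq_trans (ltnW (ltn_ceil n C_gt0)) _.
  by rewrite mulSn addnC leq_add2l leq_pmull.
have [h inj_h far_h] := pack A n A_gt0 leAn.
have d_gt0 : 0 < d by apply: leq_trans hd.
have bound : A ^ e <= n.+1 * ('C(n, d) - #|F|).
  have := packing_bound d_gt0 unifF vcF inj_h.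
  rewrite card_ffun !card_ord; apply=> f g fg.
  by rewrite addnC -ltn_subRL; exact: far_h.
set m := _ - _ in bound.
have n_gt0 : 0 < n by apply: leq_trans leCn.
(* Positivity shows that the truncated subtraction in [m] is exact. *)
have m_gt0 : 0 < m.
  have : 0 < n.+1 * m by apply: leq_trans bound; rewrite expn_gt0 A_gt0.
  by rewrite muln_gt0.
have cE : (c * n%:R ^+ (d - 4) <= m%:R :> rat)%R.
  rewrite /c mulrC ler_pdivrMr ?ltr0n ?muln_gt0 ?expn_gt0 ?muln_gt0 ?C_gt0 //.
  rewrite -natrX -natrM ler_nat -(leq_pmul2l n_gt0) -expnS -eE.
  apply: (@leq_trans ((A * (2 * C)) ^ e)); first by rewrite leq_exp2r // eE.
  rewrite expnMn !mulnA leq_mul2r; apply/orP; right; apply: leq_trans bound _.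
  by rewrite mulSn muln2 -addnn leq_add2r leq_pmull.
rewrite lerBrDr (le_trans (lerD (lexx _) cE)) // -natrD ler_nat subnKC //.
by rewrite ltnW // -subn_gt0.
Qed.
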